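(* Let $H\ne\mathbb{Z}_+$ be a semigroup of natural numbers for which there is a natural number $n$ such that $s\in H$ for all $s\ge n$; let $n$ be the minimal such number. Let $d_1\in H$ and let $d_2$ be the minimal element of $H\setminus d_1\mathbb{Z}_+$ such that $\gcd(d_1,d_2)=1$. Then $d_1,d_2$ generate a subsemigroup $d_1\mathbb{Z}_++d_2\mathbb{Z}_+\subset H$ such that every number $s>(d_1-1)(d_2-1)$ is in $d_1\mathbb{Z}_++d_2\mathbb{Z}_+\subset H$. In particular $$n\le (d_1-1)(d_2-1).$$ If $d_1,d_2$ generate the semigroup $H$, then $n=(d_1-1)(d_2-1)$.
   Context: $\mathbb{Z}_+$ denotes the set of non-negative integers; a semigroup of natural numbers is an additive subsemigroup of $\mathbb{Z}_+$ containing $0$. *)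

(* Defs.v *)
(* MathComp world, with the set library of mathcomp-classical. *)
From mathcomp Require Import all_boot all_order.
From mathcomp Require Import classical_sets.

Set Implicit Arguments.
Unset Strict Implicit.
Unset Printing Implicit Defensive.

Local Open Scope classical_set_scope.

Definition nat_semigroup (H : set nat) : Prop :=
  H 0 /\ (forall a b : nat, H a -> H b -> H (a + b)).

Definition is_minimum (A : set nat) (m : nat) : Prop := A m /\ lbound A m.

Definition multiples (d : nat) : set nat := range (muln d).

Definition sumset (A B : set nat) : set nat :=
  [set a + b | a in A & b in B].

Definition generated (A : set nat) : set nat := smallest nat_semigroup A.

(* Main.v *)
Require Import Defs.
From mathcomp Require Import all_boot all_order.
From mathcomp Require Import classical_sets.
From mathcomp Require Import zify.

Local Open Scope classical_set_scope.

(** This is Sylvester's solution of the two-coin problem. For coprime positive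
    [a] and [b], an integer [s] is congruent modulo [a] to a unique [b * y] with
    [0 <= y < a], and [s] is of the form [a * x + b * y'] with [x, y' >= 0]
    exactly when this smallest candidate [b * y] does not exceed [s].

    The candidates are at most [b * (a - 1)]; one that exceeds [s] does so by a
    multiple of [a], hence by at least [a]. So every
    [s >= b * (a - 1) - a + 1 = (a - 1) * (b - 1)] is represented
    ([sumset_coprime_ge]). The bound is sharp: [a * b - a - b] is not
    represented when [a] and [b] exceed 1, since otherwise [a * b] would be a sum
    of positive multiples of [a] and [b], and coprimality makes the first of them
    at least [a * b] on its own
    ([frobenius_number_notin]).

    The conductor [n] of [H] is therefore at most [(d1 - 1) * (d2 - 1)], and it
    cannot be smaller when [H] is generated by [d1] and [d2], because the
    predecessor of [(d1 - 1) * (d2 - 1)] is then missing from [H]. Properness of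
    [H] excludes the degenerate values 0 and 1 of [d1] and [d2]: by coprimality
    each of them would put 1 in [H]. *)

Lemma sumset_multiplesP (a b s : nat) :
  sumset (multiples a) (multiples b) s <-> exists x y, s = a * x + b * y.
Proof.
split=> [[_ [x _ <-] [_ [y _ <-] <-]]|[x [y ->]]]; first by exists x, y.
by exists (a * x); [exists x | exists (b * y); [exists y|]].
Qed.

Lemma nat_semigroup_mul (M : set nat) (a x : nat) :
  nat_semigroup M -> M a -> M (a * x).
Proof.
move=> [M0 MD] Ma; elim: x => [|x IHx]; first by rewrite muln0.
by rewrite mulnS; apply: MD.
Qed.

Lemma nat_semigroup_sumset_sub (M : set nat) (a b : nat) :
  nat_semigroup M -> M a -> M b ->
  sumset (multiples a) (multiples b) `<=` M.
Proof.
move=> sgM Ma Mb s /sumset_multiplesP[x [y ->]].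
by apply: sgM.2; apply: nat_semigroup_mul.
Qed.

Lemma nat_semigroup1 (M : set nat) : nat_semigroup M -> M 1 -> M = [set: nat].
Proof.
move=> sgM M1; apply/seteqP; split=> // s _.
by rewrite -(mul1n s); apply: nat_semigroup_mul.
Qed.

Lemma nat_semigroup_sumset (a b : nat) :
  nat_semigroup (sumset (multiples a) (multiples b)).
Proof.
split=> [|s t]; first by apply/sumset_multiplesP; exists 0, 0; rewrite !muln0.
move=> /sumset_multiplesP[x [y ->]] /sumset_multiplesP[x' [y' ->]].
by apply/sumset_multiplesP; exists (x + x'), (y + y'); rewrite !mulnDr addnACA.
Qed.

Lemma generated_pair (a b : nat) :
  generated [set a; b] = sumset (multiples a) (multiples b).
Proof.
apply/seteqP; split=> [|s ss M [sgM abM]].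
  apply: smallest_sub; first exact: nat_semigroup_sumset.
  move=> _ [] ->; apply/sumset_multiplesP.
    by exists 1, 0; rewrite muln1 muln0 addn0.
  by exists 0, 1; rewrite muln1 muln0.
by apply: nat_semigroup_sumset_sub ss => //; apply: abM; [left|right].
Qed.

(** By the Chinese remainder theorem some number is congruent to [s] modulo [a]
    and to 0 modulo [b]; its quotient by [b] can be reduced modulo [a]. *)
Lemma coprime_mul_congr (a b s : nat) : 0 < a -> coprime a b ->
  exists2 y, y < a & b * y = s %[mod a].
Proof.
move=> a_gt0 co_ab.
have /dvdnP[w chE] : b %| chinese a b s 0.
  by rewrite /dvdn chinese_modr // mod0n.
exists (w %% a); first by rewrite ltn_mod.
by rewrite modnMmr mulnC -chE chinese_modl.
Qed.

Lemma sumset_coprime_ge (a b s : nat) : 0 < a -> 0 < b -> coprime a b ->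
  (a - 1) * (b - 1) <= s -> sumset (multiples a) (multiples b) s.
Proof.
move=> a_gt0 b_gt0 co_ab le_s; apply/sumset_multiplesP.
have [y lt_ya eq_bys] := coprime_mul_congr a b s a_gt0 co_ab.
have [le_bys|lt_sby] := leqP (b * y) s.
  have /dvdnP[x xE] : a %| s - b * y by rewrite -eqn_mod_dvd // eq_bys.
  by exists x, y; rewrite (mulnC a) -xE subnK.
have /dvdnP[k kE] : a %| b * y - s by rewrite -eqn_mod_dvd ?eq_bys // ltnW.
(* A candidate exceeding [s] overshoots by at least [a], which would force
   [s <= b * (a - 1) - a], the predecessor of [(a - 1) * (b - 1)]. *)
have le_a : a <= b * y - s.
  by rewrite kE leq_pmull // lt0n; apply/eqP => k0; move: kE lt_sby; lia.
have le_by : b * y <= b * (a - 1) by rewrite leq_mul2l; lia.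
nia.
Qed.

(** The number in question is [a * b - a - b]: a representation [a * x + b * y]
    of it gives [a * b = a * (x + 1) + b * (y + 1)], where [b] must divide
    [x + 1], so that the first term already reaches [a * b]. When [a] or [b] is 1
    the truncated predecessor is 0, which is represented. *)
Lemma frobenius_number_notin (a b : nat) : 1 < a -> 1 < b -> coprime a b ->
  ~ sumset (multiples a) (multiples b) ((a - 1) * (b - 1)).-1.
Proof.
move=> a_gt1 b_gt1 co_ab /sumset_multiplesP[x [y xyE]].
have abE : a * b = a * x.+1 + b * y.+1 by nia.
have b_dvd : b %| x.+1.
  rewrite -(@Gauss_dvdr b a) 1?coprime_sym //.
  by rewrite -(dvdn_addl _ (dvdn_mulr y.+1 (dvdnn b))) -abE dvdn_mull.
have le_ab : a * b <= a * x.+1 by rewrite leq_mul2l dvdn_leq ?orbT.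
by move: le_ab; rewrite abE; lia.
Qed.

Theorem lemma48 (H : set nat) (n d1 d2 : nat)
  (semigroupH : nat_semigroup H)
  (properH : H <> [set: nat])
  (n_min : is_minimum [set m : nat | forall s : nat, m <= s -> H s] n)
  (d1H : H d1)
  (d2_min : is_minimum
     [set d : nat | (H `\` multiples d1) d /\ gcdn d1 d = 1] d2) :
  [/\ generated [set d1; d2] = sumset (multiples d1) (multiples d2),
      sumset (multiples d1) (multiples d2) `<=` H,
      forall s : nat, (d1 - 1) * (d2 - 1) < s ->
        sumset (multiples d1) (multiples d2) s,
      n <= (d1 - 1) * (d2 - 1)
    & generated [set d1; d2] = H -> n = (d1 - 1) * (d2 - 1)].
Proof.
case: n_min => /= nH n_lb; case: d2_min => /= -[[d2H _] gcd1] _.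
have notH1 : ~ H 1 by move/(nat_semigroup1 _ semigroupH).
have d1_gt1 : 1 < d1.
  case: d1 d1H gcd1 => [|[|d]] // _.
  by rewrite gcd0n => d21; move: d2H; rewrite d21.
have d2_gt1 : 1 < d2.
  case: d2 d2H gcd1 => [|[|d]] // _.
  by rewrite gcdn0 => d11; move: d1H; rewrite d11.
have co_d : coprime d1 d2 by apply/eqP.
have subH := nat_semigroup_sumset_sub _ _ _ semigroupH d1H d2H.
have repr s : (d1 - 1) * (d2 - 1) <= s ->
    sumset (multiples d1) (multiples d2) s.
  by apply: sumset_coprime_ge => //; apply: ltnW.
have le_n : n <= (d1 - 1) * (d2 - 1).
  by apply: n_lb => s /repr; apply: subH.
split=> //; first exact: generated_pair.
  by move=> s /ltnW; apply: repr.
rewrite generated_pair => genH.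
apply/eqP; rewrite eqn_leq le_n leqNgt; apply/negP => lt_n.
apply: (frobenius_number_notin _ _ d1_gt1 d2_gt1 co_d).
by rewrite genH; apply: nH; lia.
Qed.
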